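(* Let $F_1,\dots,F_n$ be independent random variables taking values in the set of monotone non-decreasing functions from $\mathbb R$ to $[0,1]$, and let $F_{\mathrm{avg}}=\frac1n(F_1+\cdots+F_n)$. Then $$\mathbb E\big[\|F_{\mathrm{avg}}-\mathbb EF_{\mathrm{avg}}\|_\infty\big]\le Cn^{-1/2}$$ for a universal constant $C$ not depending on $n$ or on the distributions of $F_1,\dots,F_n$.
   Context: $\|F\|_\infty=\sup_{v\in\mathbb R}|F(v)|$, and $\mathbb EF_{\mathrm{avg}}$ denotes the pointwise expectation $v\mapsto\mathbb E[F_{\mathrm{avg}}(v)]$. *)

(* Defs.v *)
From HB Require Import structures.
From mathcomp Require Import all_boot all_order all_algebra.
From mathcomp Require Import all_classical all_reals all_analysis.
Set Implicit Arguments. Unset Strict Implicit. Unset Printing Implicit Defensive.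
Import Order.TTheory GRing.Theory Num.Theory.
Import numFieldNormedType.Exports.
Local Open Scope classical_set_scope.
Local Open Scope ring_scope.

Section defs.
Context {R : realType} {d : measure_display} {T : measurableType d}.

(* sigma-algebra on T generated by a function-valued random variable
   F : T -> (R -> R), where the space of functions R -> R carries the
   (product / cylinder) sigma-algebra generated by the evaluation maps *)
Definition fun_rv_sigma (F : T -> R -> R) : set (set T) :=
  <<s [set A | exists (v : R) (B : set R),
        measurable B /\ A = (fun w => F w v) @^-1` B] >>.

Definition mutually_independent (P : probability T R) (n : nat)
    (G : 'I_n -> set (set T)) : Prop :=
  forall (J : {set 'I_n}) (E : 'I_n -> set T),
    (forall i, i \in J -> G i (E i)) ->
    P (\bigcap_(i in [set` J]) E i) = (\prod_(i in J) P (E i))%E.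

Definition independent_fun_rvs (P : probability T R) (n : nat)
    (F : 'I_n -> T -> R -> R) : Prop :=
  mutually_independent P (fun i => fun_rv_sigma (F i)).

Definition Favg (n : nat) (F : 'I_n -> T -> R -> R) : T -> R -> R :=
  fun w v => n%:R^-1 * \sum_(i < n) F i w v.

Definition EFavg (P : probability T R) (n : nat) (F : 'I_n -> T -> R -> R)
    : R -> R :=
  fun v => Rintegral P setT (fun w => Favg F w v).

End defs.

Definition supnorm {R : realType} (h : R -> R) : \bar R :=
  ereal_sup [set (`|h v|)%:E | v in [set: R]].

(* Main.v *)
Require Import Defs.
From HB Require Import structures.
From mathcomp Require Import all_boot all_order all_algebra.
From mathcomp Require Import all_classical all_reals all_analysis.
From mathcomp Require Import measurable_realfun.
From mathcomp Require Import zify ring lra.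
Import Order.TTheory GRing.Theory Num.Theory.
Import numFieldNormedType.Exports.
Local Open Scope classical_set_scope.
Local Open Scope ring_scope.

(* Write D = F_avg - E F_avg and G = E F_avg.  A fourth moment computation for
   sums of independent centered variables gives, whenever |G b - G a| <= e,
     E (D b - D a)^4 <= e / n^3 + 3 e^2 / n^2.
   Chaining along nets which are 2^-k-dense for the pseudo-distance |G b - G a|
   and have O(2^k) points, the maxima over each level are controlled by
   |x| <= a + x^4 / a^3 with a = (9/10)^k / sqrt n; the fourth moments beat the
   number of points, so the levels 2^-k >= n^-1/2 contribute a geometric series
   times n^-1/2.  At the last level monotonicity brackets F_avg v between its
   values at two points of the same cell of G.  The cells need not contain their
   end points, because G may jump, so the brackets are taken along sequences
   exhausting the cells, and Fatou's lemma passes to the limit. *)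

(* The integral of a nonnegative function is a supremum over the simple functions
   below it, so no measurability is required; the sup norm need not be measurable. *)
Lemma ge0_le_lower_integral {R : realType} {d} {T : measurableType d}
    (mu : {measure set T -> \bar R}) (f g : T -> \bar R) :
    (forall w, 0 <= f w)%E -> (forall w, f w <= g w)%E ->
  (\int[mu]_w f w <= \int[mu]_w g w)%E.
Proof.
move=> f0 fg; have g0 w : (0 <= g w)%E by exact: le_trans (fg w).
rewrite !ge0_integralTE//; apply: ereal_sup_le => _ [h hf <-].
by exists h => // x; exact: le_trans (hf x) (fg x).
Qed.

(** * Expectations of bounded random variables *)

Section bounded_rv.
Local Set Implicit Arguments.
Local Unset Strict Implicit.
Context {R : realType} {d : measure_display} {T : measurableType d}.
Variable P : probability T R.
Implicit Types (X Y W g : T -> R) (A : set T).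

Local Notation Ex X := (Rintegral P setT X).

(** A class closed under sums, products and powers in which every expectation is finite, so
    linearity applies with no separate integrability argument. *)
Definition bounded_rv X :=
  measurable_fun setT X /\ exists M, forall w, `|X w| <= M.

Lemma bounded_rv_integrable X : bounded_rv X ->
  P.-integrable setT (EFin \o X).
Proof.
move=> [mX [M XM]]; apply: measurable_bounded_integrable => //.
  by rewrite (_ : _ setT = 1%E) ?ltry//; exact: probability_setT.
exists M; split; first by rewrite num_real.
by move=> N MN w _; exact: le_trans (XM w) (ltW MN).
Qed.

Lemma bounded_rv_cst (c : R) : bounded_rv (fun=> c).
Proof. by split; [exact: measurable_cst | exists `|c|]. Qed.

Lemma bounded_rv_indic A : measurable A -> bounded_rv \1_A.
Proof.
move=> mA; split; first exact: measurable_indic.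
by exists 1 => w; rewrite indicE; case: (_ \in _); rewrite ?normr1 ?normr0.
Qed.

Lemma bounded_rvD X Y : bounded_rv X -> bounded_rv Y ->
  bounded_rv (fun w => X w + Y w).
Proof.
move=> [mX [M XM]] [mY [N YN]]; split; first exact: measurable_funD.
exists (M + N) => w; apply: le_trans (ler_normD _ _) _; exact: lerD.
Qed.

Lemma bounded_rvM X Y : bounded_rv X -> bounded_rv Y ->
  bounded_rv (fun w => X w * Y w).
Proof.
move=> [mX [M XM]] [mY [N YN]]; split; first exact: measurable_funM.
by exists (M * N) => w; rewrite normrM ler_pM.
Qed.

Lemma bounded_rvB X Y : bounded_rv X -> bounded_rv Y ->
  bounded_rv (fun w => X w - Y w).
Proof.
move=> [mX [M XM]] [mY [N YN]]; split; first exact: measurable_funB.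
exists (M + N) => w; apply: le_trans (ler_normB _ _) _; exact: lerD.
Qed.

Lemma bounded_rvX X k : bounded_rv X -> bounded_rv (fun w => X w ^+ k).
Proof.
move=> bX; elim: k => [|k IH]; first exact: bounded_rv_cst.
under eq_fun do rewrite exprS.
exact: (bounded_rvM bX IH).
Qed.

Lemma bounded_rv_sum (I : Type) (r : seq I) (Q : pred I) (X : I -> T -> R) :
  (forall i, Q i -> bounded_rv (X i)) ->
  bounded_rv (fun w => \sum_(i <- r | Q i) X i w).
Proof.
move=> bX; elim: r => [|i r IH].
  under eq_fun do rewrite big_nil.
  exact: bounded_rv_cst.
under eq_fun do rewrite big_cons.
case Qi: (Q i) => //.
by apply: bounded_rvD => //; exact: bX.
Qed.

Lemma Ex_cst (c : R) : Ex (fun=> c) = c.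
Proof.
rewrite Rintegral_cst// [X in fine X](_ : _ = 1%E) ?mulr1//.
exact: probability_setT.
Qed.

Lemma Ex_indic A : measurable A -> Ex \1_A = fine (P A).
Proof. by move=> mA; rewrite /Rintegral integral_indic// setIT. Qed.

Lemma eq_Ex X Y : X =1 Y -> Ex X = Ex Y.
Proof. by move=> /funext ->. Qed.

Lemma ExD X Y : bounded_rv X -> bounded_rv Y ->
  Ex (fun w => X w + Y w) = Ex X + Ex Y.
Proof. by move=> bX bY; rewrite RintegralD//; exact: bounded_rv_integrable. Qed.

Lemma ExB X Y : bounded_rv X -> bounded_rv Y ->
  Ex (fun w => X w - Y w) = Ex X - Ex Y.
Proof. by move=> bX bY; rewrite RintegralB//; exact: bounded_rv_integrable. Qed.

Lemma ExZl (c : R) X : bounded_rv X -> Ex (fun w => c * X w) = c * Ex X.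
Proof. by move=> bX; rewrite RintegralZl//; exact: bounded_rv_integrable. Qed.

Lemma Ex_sum (I : Type) (r : seq I) (Q : pred I) (X : I -> T -> R) :
  (forall i, Q i -> bounded_rv (X i)) ->
  Ex (fun w => \sum_(i <- r | Q i) X i w) = \sum_(i <- r | Q i) Ex (X i).
Proof.
move=> bX; elim: r => [|i r IH].
  rewrite big_nil; under eq_fun do rewrite big_nil.
  exact: Ex_cst.
rewrite big_cons; under eq_fun do rewrite big_cons.
case Qi: (Q i) => //.
by rewrite ExD ?IH//; [exact: bX | exact: bounded_rv_sum].
Qed.

Lemma Ex_le X Y : bounded_rv X -> bounded_rv Y -> (forall w, X w <= Y w) ->
  Ex X <= Ex Y.
Proof.
by move=> bX bY XY; apply: le_Rintegral => //; exact: bounded_rv_integrable.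
Qed.

Lemma Ex_norm_le X (M : R) : bounded_rv X -> (forall w, `|X w| <= M) ->
  `|Ex X| <= M.
Proof.
move=> bX XM; rewrite ler_norml -(Ex_cst M) -(Ex_cst (- _)).
have bc c := bounded_rv_cst c.
apply/andP; split; rewrite ?Ex_cst.
  rewrite -[leLHS]Ex_cst; apply: Ex_le => // w.
  by have := XM w; rewrite ler_norml => /andP[].
rewrite -[leRHS]Ex_cst; apply: Ex_le => // w.
by have := XM w; rewrite ler_norml => /andP[].
Qed.

Lemma Ex_EFin X : bounded_rv X -> (\int[P]_w (X w)%:E)%E = (Ex X)%:E.
Proof.
move=> bX; rewrite /Rintegral fineK//.
by apply: integrable_fin_num => //; exact: bounded_rv_integrable.
Qed.

Lemma measurable_superlevel g (t : R) : measurable_fun setT g ->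
  measurable [set w | t <= g w].
Proof.
move=> mg; rewrite (_ : mkset _ = setT `&` g @^-1` `[t, +oo[%classic).
  exact: mg.
by apply/seteqP; split => w /=; rewrite in_itv/= andbT; tauto.
Qed.

(** The sum counts the [k] with [k < Num.truncn (x * N)], so the average is [x] rounded down to a
    multiple of [1 / N]. *)
Lemma sum_superlevel_approx (N : nat) (x : R) : (0 < N)%N -> 0 <= x <= 1 ->
  `|x - N%:R^-1 * \sum_(k < N) (k.+1%:R / N%:R <= x)%R%:R| <= N%:R^-1.
Proof.
move=> N0 /andP[x0 x1]; have N0' : (0 : R) < N%:R by rewrite ltr0n.
have Nx0 : 0 <= x * N%:R by rewrite mulr_ge0.
have count m M : \sum_(k < M) (k < m)%N%:R = (minn m M)%:R :> R.
  elim: M => [|M IH]; first by rewrite big_ord0 minn0.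
  rewrite big_ord_recr/= IH -natrD; congr (_%:R).
  by case: (ltnP M m) => /= ?; lia.
have /andP[lo hi] := truncn_itv Nx0.
rewrite (eq_bigr (fun k : 'I_N => (k < Num.truncn (x * N%:R))%N%:R)); last first.
  by move=> k _; rewrite ler_pdivrMr// truncn_gt_nat.
rewrite count (minn_idPl _); last first.
  rewrite -(ler_nat R); apply: le_trans lo _.
  by rewrite -[leRHS]mul1r ler_pM2r.
rewrite -[X in X - _](mulKf (lt0r_neq0 N0')) -mulrBr normrM ger0_norm ?invr_ge0//.
rewrite -[leRHS]mulr1 ler_pM2l ?invr_gt0//.
by rewrite [_ * x]mulrC ler_norml; move: lo hi; rewrite -natr1; lra.
Qed.

(* Layer-cake argument: [g] is the uniform limit of the averages of the
   indicators of its superlevel sets at heights [k.+1 / N]. *)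
Lemma Ex_mul_superlevel01 W g : bounded_rv W -> measurable_fun setT g ->
    (forall w, 0 <= g w <= 1) ->
    (forall t, Ex (fun w => W w * \1_[set w | t <= g w] w) =
               Ex W * Ex \1_[set w | t <= g w]) ->
  Ex (fun w => W w * g w) = Ex W * Ex g.
Proof.
move=> bW mg g01 HW; have [_ [M WM]] := bW.
have M0 : 0 <= M by exact: le_trans (normr_ge0 _) (WM point).
have bg : bounded_rv g.
  split=> //; exists 1 => w; have /andP[g0 g1] := g01 w.
  by rewrite ger0_norm.
pose s N k := \1_[set w | k.+1%:R / N%:R <= g w] : T -> R.
have bs N k : bounded_rv (s N k).
  by apply: bounded_rv_indic; exact: measurable_superlevel.
pose gN N w := N%:R^-1 * \sum_(k < N) s N k w.
have bgN N : bounded_rv (gN N).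
  by apply: bounded_rvM; [exact: bounded_rv_cst | exact: bounded_rv_sum].
have approx N : (0 < N)%N -> forall w, `|g w - gN N w| <= N%:R^-1.
  move=> N0 w; have := sum_superlevel_approx N0 (g01 w).
  congr (`|_ - _ * _| <= _); apply: eq_bigr => k _.
  by rewrite /s indicE; congr ((nat_of_bool _)%:R); apply/idP/idP; rewrite inE.
have fact N : Ex (fun w => W w * gN N w) = Ex W * Ex (gN N).
  have bWs k : bounded_rv (fun w => W w * s N k w) by exact: bounded_rvM.
  rewrite (@eq_Ex _ (fun w => N%:R^-1 * \sum_(k < N) W w * s N k w)); last first.
    by move=> w; rewrite /gN mulrCA mulr_sumr.
  rewrite (ExZl _ (X := fun w => \sum_(k < N) s N k w)); last first.
    exact: bounded_rv_sum.
  rewrite ExZl; last exact: bounded_rv_sum.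
  rewrite !Ex_sum// [RHS]mulrCA; congr (_ * _).
  rewrite mulr_sumr; apply: eq_bigr => k _.
  exact: HW.
(* By [fact], replacing [g] by [gN N] costs at most [M / N] in each of the two terms. *)
have main N : (0 < N)%N ->
    `|Ex (fun w => W w * g w) - Ex W * Ex g| <= 2 * M * N%:R^-1.
  move=> N0.
  have bd := bounded_rvB bg (bgN N).
  have -> : Ex (fun w => W w * g w) - Ex W * Ex g =
      Ex (fun w => W w * (g w - gN N w)) - Ex W * Ex (fun w => g w - gN N w).
    rewrite (@eq_Ex (fun w => W w * (g w - gN N w))
      (fun w => W w * g w - W w * gN N w)); last by move=> w; rewrite mulrBr.
    have bWg := bounded_rvM bW bg; have bWgN := bounded_rvM bW (bgN N).
    by rewrite (ExB bWg bWgN) (ExB bg (bgN N)) fact; ring.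
  have -> : 2 * M * N%:R^-1 = M * N%:R^-1 + M * N%:R^-1 by ring.
  apply: le_trans (ler_normB _ _) _; rewrite [X in _ + X]normrM.
  apply: lerD.
    apply: Ex_norm_le => [|w]; first exact: bounded_rvM.
    by rewrite normrM ler_pM// approx.
  by rewrite ler_pM// Ex_norm_le// => w; exact: approx.
apply/eqP; rewrite -subr_eq0 -normr_le0; apply/ler_addgt0Pl => e e0.
rewrite addr0.
apply: le_trans (main (Num.truncn (e^-1 * (2 * M))).+1 isT) _.
rewrite ler_pdivrMr ?ltr0n// -ler_pdivrMl//.
by apply/ltW/truncnS_gt.
Qed.

(** Both sides are affine in [g], and increasing affine maps send superlevel sets to superlevel
    sets, so [g] can be rescaled into [0,1]. *)
Lemma Ex_mul_superlevel W g : bounded_rv W -> bounded_rv g ->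
    (forall t, Ex (fun w => W w * \1_[set w | t <= g w] w) =
               Ex W * Ex \1_[set w | t <= g w]) ->
  Ex (fun w => W w * g w) = Ex W * Ex g.
Proof.
move=> bW bg HW; have [mg [M gM]] := bg.
(* The maximum with 1 keeps the scaling factor positive even when [M] vanishes. *)
pose N := Num.max M 1; have N0 : 0 < N by rewrite lt_max ltr01 orbT.
have gN w : - N <= g w <= N by rewrite -ler_norml le_max gM.
pose h w := (2 * N)^-1 * (g w + N).
have bh : bounded_rv h.
  by apply: bounded_rvM; [exact: bounded_rv_cst|
    apply: bounded_rvD => //; exact: bounded_rv_cst].
have gh w : g w = 2 * N * h w - N.
  by rewrite /h mulrA mulfV ?mul1r ?addrK// mulf_neq0 ?pnatr_eq0// gt_eqF.
have h01 w : 0 <= h w <= 1.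
  have /andP[? ?] := gN w; rewrite /h mulr_ge0 ?invr_ge0/=; [|lra..].
  by rewrite mulrC ler_pdivrMr; lra.
have Wh : Ex (fun w => W w * h w) = Ex W * Ex h.
  apply: Ex_mul_superlevel01 => // [|t]; first by case: bh.
  rewrite (_ : [set w | t <= h w] = [set w | 2 * N * t - N <= g w]) ?HW//.
  apply/seteqP; split => w /=; rewrite gh lerD2r ler_pM2l//; lra.
rewrite (eq_Ex gh) (@eq_Ex _ (fun w => 2 * N * (W w * h w) - N * W w)); last first.
  by move=> w; rewrite gh; ring.
have bc c := bounded_rv_cst c; have bWh := bounded_rvM bW bh.
rewrite (ExB (bounded_rvM (bc _) bWh) (bounded_rvM (bc _) bW)).
rewrite (ExB (bounded_rvM (bc _) bh) (bc _)).
rewrite (ExZl _ bh) (ExZl _ bWh) (ExZl _ bW) Ex_cst Wh; ring.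
Qed.

End bounded_rv.

(** * Factorisation of expectations under independence *)

Section independence.
Local Set Implicit Arguments.
Local Unset Strict Implicit.
Context {R : realType} {d : measure_display} {T : measurableType d}.
Variables (P : probability T R) (n : nat) (G : 'I_n -> set (set T)).
Hypothesis G_setT : forall i, G i setT.
Hypothesis G_measurable : forall i A, G i A -> measurable A.
Hypothesis G_independent : mutually_independent P G.

Local Notation Ex X := (Rintegral P setT X).
Local Notation bounded_rv := (@bounded_rv R d T).

(** Product events in the coordinates of index at least [m]. Full slots below [m] allow one product
    over ['I_n] to serve for every [m]. *)
Definition rectangle (m : nat) (B : set T) := exists E : 'I_n -> set T,
  [/\ forall i, G i (E i), forall i : 'I_n, (i < m)%N -> E i = setT
    & B = \bigcap_i E i].

Lemma rectangle_measurable m B : rectangle m B -> measurable B.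
Proof.
move=> [E [GE _ ->]]; apply: fin_bigcap_measurable => [|i _]; first exact: finite_finset.
exact: G_measurable (GE i).
Qed.

Lemma rectangle_setT m : rectangle m setT.
Proof. by exists (fun=> setT); split => //; apply/seteqP; split. Qed.

Lemma rectangleW m B : rectangle m.+1 B -> rectangle m B.
Proof.
move=> [E [GE E1 ->]]; exists E; split => // i im; apply: E1; exact: ltnW.
Qed.

Lemma rectangle_prob (E : 'I_n -> set T) : (forall i, G i (E i)) ->
  P (\bigcap_i E i) = (\prod_i P (E i))%E.
Proof.
move=> GE; have := @G_independent [set i : 'I_n | true]%SET E (fun i _ => GE i).
rewrite (_ : [set` _] = setT); last first.
  by apply/seteqP; split => i //= _; rewrite inE.
by move=> ->; apply: eq_bigl => i; rewrite inE.
Qed.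

(** Slot [i] of [B] is the whole space, so [A] can be placed there; independence then splits off the
    factor [P A]. *)
Lemma rectangleI (i : 'I_n) A B : G i A -> rectangle i.+1 B ->
  rectangle i (B `&` A) /\ Ex \1_(B `&` A) = Ex \1_B * Ex \1_A.
Proof.
move=> GA rB; have [E [GE E1 EB]] := rB.
pose E' j := if j == i then A else E j.
have GE' j : G j (E' j) by rewrite /E'; case: eqP => [->|].
have Ei : E i = setT by exact: E1.
have BA : B `&` A = \bigcap_j E' j.
  apply/seteqP; split => w.
    rewrite EB => -[Ew Aw] j _; rewrite /E'; case: eqP => // _; exact: Ew.
  move=> Ew; split; last by have := Ew i Logic.I; rewrite /E' eqxx.
  rewrite EB => j _; have := Ew j Logic.I; rewrite /E'.
  by case: eqP => [->|//]; rewrite Ei.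
have rBA : rectangle i (B `&` A).
  exists E'; split => // j ji; rewrite /E'; case: eqP ji => [->|_ ji].
    by rewrite ltnn.
  by apply: E1; exact: ltnW.
split=> //; rewrite !Ex_indic; [|exact: G_measurable GA
  |exact: rectangle_measurable rB|exact: rectangle_measurable rBA].
rewrite BA EB !rectangle_prob// -fineM ?fin_num_measure//; last 2 first.
- by rewrite -rectangle_prob// -EB fin_num_measure//; exact: rectangle_measurable rB.
- exact: G_measurable GA.
congr fine; rewrite [LHS](bigD1 i)//= [in RHS](bigD1 i)//= {1}/E' eqxx Ei.
rewrite (probability_setT P) mul1e muleC; congr (_ * _)%E.
by apply: eq_bigr => j /negPf ji; rewrite /E' ji.
Qed.

(* [W] behaves like a random variable depending only on the coordinates of index
   below [m]. *)
Definition decoupled (m : nat) (W : T -> R) := bounded_rv W /\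
  forall B, rectangle m B -> Ex (fun w => W w * \1_B w) = Ex W * Ex \1_B.

Lemma decoupled_cst m (c : R) : decoupled m (fun=> c).
Proof.
split=> [|B rB]; first exact: bounded_rv_cst.
rewrite ExZl ?Ex_cst//; apply: bounded_rv_indic; exact: rectangle_measurable rB.
Qed.

Lemma decoupledD m X Y : decoupled m X -> decoupled m Y ->
  decoupled m (fun w => X w + Y w).
Proof.
move=> [bX HX] [bY HY]; split=> [|B rB]; first exact: bounded_rvD.
have bB : bounded_rv \1_B.
  by apply: bounded_rv_indic; exact: rectangle_measurable rB.
rewrite (ExD _ bX bY) mulrDl -HX// -HY//.
rewrite -(ExD _ (bounded_rvM bX bB) (bounded_rvM bY bB)).
by apply: eq_Ex => w; rewrite mulrDl.
Qed.

Lemma decoupledZl m (c : R) X : decoupled m X -> decoupled m (fun w => c * X w).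
Proof.
move=> [bX HX]; split=> [|B rB].
  by apply: bounded_rvM => //; exact: bounded_rv_cst.
have bB : bounded_rv \1_B.
  by apply: bounded_rv_indic; exact: rectangle_measurable rB.
rewrite (ExZl _ _ bX) -mulrA -HX// -(ExZl _ _ (bounded_rvM bX bB)).
by apply: eq_Ex => w; rewrite mulrA.
Qed.

Lemma decoupled_sum m (I : Type) (r : seq I) (X : I -> T -> R) :
  (forall i, decoupled m (X i)) -> decoupled m (fun w => \sum_(i <- r) X i w).
Proof.
move=> HX; elim: r => [|i r IH].
  under eq_fun do rewrite big_nil.
  exact: decoupled_cst.
under eq_fun do rewrite big_cons.
exact: decoupledD.
Qed.

(** Measurability with respect to [G i], phrased by preimages because [G i] is a bare family of
    sets. *)
Definition adapted (i : 'I_n) (g : T -> R) :=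
  forall B : set R, measurable B -> G i (g @^-1` B).

(** Superlevel sets of [g] lie in [G i], so they cut a rectangle of level [i.+1] into one of level
    [i], from which [W] is decoupled. The layer-cake argument applied to [W * \1_B] then factors out
    [g]. *)
Lemma decoupledM (i : 'I_n) W g : decoupled i W -> bounded_rv g -> adapted i g ->
  Ex (fun w => W w * g w) = Ex W * Ex g /\ decoupled i.+1 (fun w => W w * g w).
Proof.
move=> [bW HW] bg ag.
have fact B : rectangle i.+1 B ->
    Ex (fun w => W w * g w * \1_B w) = Ex W * Ex \1_B * Ex g.
  move=> rB.
  have bB : bounded_rv \1_B.
    by apply: bounded_rv_indic; exact: rectangle_measurable rB.
  rewrite -HW; last exact: rectangleW.
  rewrite -(Ex_mul_superlevel (bounded_rvM bW bB) bg).
    by apply: eq_Ex => w; rewrite mulrAC.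
  move=> t; rewrite HW; last exact: rectangleW.
  have GA : G i [set w | t <= g w].
    rewrite (_ : mkset _ = g @^-1` `[t, +oo[%classic); first exact: ag.
    by apply/seteqP; split => w /=; rewrite in_itv/= andbT.
  have [rBA PBA] := rectangleI GA rB.
  rewrite -mulrA -PBA -HW//; apply: eq_Ex => w.
  by rewrite -mulrA indicI.
have facT : Ex (fun w => W w * g w) = Ex W * Ex g.
  have := fact _ (rectangle_setT _); rewrite indicT Ex_cst mulr1 => <-.
  by apply: eq_Ex => w; rewrite /= mulr1.
split=> //; split=> [|B rB]; first exact: bounded_rvM.
by rewrite fact// facT mulrAC.
Qed.

(** * Fourth moment of a sum of independent centered variables *)

Section fourth_moment.
Variable U : 'I_n -> T -> R.
Hypothesis U01 : forall i w, 0 <= U i w <= 1.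
Hypothesis mU : forall i, measurable_fun setT (U i).
Hypothesis aU : forall i, adapted i (U i).

Let Y i w := U i w - Ex (U i).
Let S (m : nat) w := \sum_(i < n | (i < m)%N) Y i w.

Let bU i : bounded_rv (U i).
Proof.
split=> //; exists 1 => w; have /andP[u0 u1] := U01 i w.
by rewrite ger0_norm.
Qed.

Let bY i : bounded_rv (Y i).
Proof. by apply: bounded_rvB => //; exact: bounded_rv_cst. Qed.

Let aYX i k : adapted i (fun w => Y i w ^+ k).
Proof.
move=> B mB; pose phi (x : R) := (x - Ex (U i)) ^+ k.
have mphi : measurable_fun setT phi.
  by apply: measurable_funX; apply: measurable_funB => //.
have := mphi measurableT _ mB; rewrite setTI => mphiB.
exact: aU mphiB.
Qed.

Let SS (i : 'I_n) w : S i.+1 w = S i w + Y i w.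
Proof.
rewrite /S (bigD1 i)//= addrC; congr (_ + _); apply: eq_bigl => j.
by rewrite ltnS ltn_neqAle andbC.
Qed.

Let decoupled_S m k : (m <= n)%N -> decoupled m (fun w => S m w ^+ k).
Proof.
elim: m k => [|m IH] k mn.
  rewrite (_ : (fun w => _) = (fun=> 0 ^+ k)); first exact: decoupled_cst.
  by apply/funext => w; rewrite /S big_pred0.
pose i := Ordinal mn.
(* The binomial expansion leaves products of a power of [S i] and a power of [Y i], which
   [decoupledM] handles. *)
rewrite (_ : (fun w => _) = (fun w => \sum_(c < k.+1)
    ('C(k, c)%:R * (S i w ^+ (k - c) * Y i w ^+ c)))); last first.
  apply/funext => w; rewrite (SS i) exprDn; apply: eq_bigr => c _.
  by rewrite mulr_natl.
apply: decoupled_sum => c; apply: decoupledZl.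
exact: (decoupledM (i := i) (IH _ (ltnW mn)) (bounded_rvX c (bY i)) (@aYX i c)).2.
Qed.

Let EY i : Ex (Y i) = 0.
Proof. by rewrite ExB ?Ex_cst ?subrr//; exact: bounded_rv_cst. Qed.

(** The variance is at most the second moment, and [x ^+ 2 <= x] on [0,1]. *)
Let EY2 i : Ex (fun w => Y i w ^+ 2) <= Ex (U i).
Proof.
have := EY i; set c := Ex (U i) => EY0.
have bc (x : R) := @bounded_rv_cst R d T x.
rewrite (@eq_Ex _ _ _ P _ (fun w => U i w ^+ 2 - (2 * c * Y i w + c ^+ 2))); last first.
  by move=> w; rewrite /Y -/c; ring.
have b2 := bounded_rvX 2 (bU i).
have b3 := bounded_rvM (bc (2 * c)) (bY i).
rewrite (ExB _ b2 (bounded_rvD b3 (bc _))) (ExD _ b3 (bc _)) (ExZl _ _ (bY i)) Ex_cst.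
rewrite EY0 mulr0 add0r lerBlDr; apply: (@le_trans _ _ c); last first.
  by rewrite lerDl sqr_ge0.
apply: Ex_le => // w; have /andP[? ?] := U01 i w; nra.
Qed.

Let EU01 i : 0 <= Ex (U i) <= 1.
Proof.
have bc (x : R) := @bounded_rv_cst R d T x.
rewrite -{1}(Ex_cst P 0) -(Ex_cst P 1).
by apply/andP; split; apply: Ex_le => // w; have /andP[] := U01 i w.
Qed.

Let EY4 i : Ex (fun w => Y i w ^+ 4) <= Ex (U i).
Proof.
apply: le_trans (EY2 i); apply: Ex_le; [exact: bounded_rvX..|] => w.
have /andP[? ?] := U01 i w; have /andP[? ?] := EU01 i.
have Y2 : Y i w ^+ 2 <= 1 by rewrite /Y; nra.
by rewrite (exprM _ 2 2) expr2 ler_piMl ?sqr_ge0.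
Qed.

(** Induction on the number of summands. Expanding [(S + Y) ^+ 4], the terms with a factor [Ex Y] or
    [Ex S] vanish, and [6 * Ex (S ^+ 2) * Ex (Y ^+ 2)] is absorbed by the cross term of
    [3 * s ^+ 2]. *)
Lemma fourth_moment_le (s := \sum_i Ex (U i)) :
  Ex (fun w => (\sum_i (U i w - Ex (U i))) ^+ 4) <= s + 3 * s ^+ 2.
Proof.
pose sm m := \sum_(i < n | (i < m)%N) Ex (U i).
have sm0 m : 0 <= sm m by apply: sumr_ge0 => i _; case/andP: (EU01 i).
suff H m : (m <= n)%N -> [/\ Ex (S m) = 0, Ex (fun w => S m w ^+ 2) <= sm m
    & Ex (fun w => S m w ^+ 4) <= sm m + 3 * sm m ^+ 2].
  have [_ _] := H n (leqnn n).
  rewrite (_ : sm n = s); last by apply: eq_bigl => i; exact: ltn_ord.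
  apply: le_trans; rewrite le_eqVlt; apply/orP; left; apply/eqP; apply: eq_Ex => w.
  by congr (_ ^+ 4); apply: eq_bigl => i; rewrite ltn_ord.
elim: m => [|m IH] mn.
  have -> : S 0 = fun=> 0 by apply/funext => w; rewrite /S big_pred0.
  rewrite /sm big_pred0// !Ex_cst; split => //; rewrite expr0n//= ?Ex_cst; lra.
have [E1 E2 E4] := IH (ltnW mn); pose i := Ordinal mn.
have DS k : decoupled i (fun w => S i w ^+ k) by apply: decoupled_S; exact: ltnW.
have E k l : Ex (fun w => S i w ^+ k * Y i w ^+ l) =
    Ex (fun w => S i w ^+ k) * Ex (fun w => Y i w ^+ l).
  exact: (decoupledM (DS k) (bounded_rvX l (bY i)) (@aYX i l)).1.
have bSY k l : bounded_rv (fun w => S i w ^+ k * Y i w ^+ l).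
  apply: bounded_rvM; last exact: bounded_rvX.
  by case: (DS k).
have bS k : bounded_rv (fun w => S i w ^+ k) by case: (DS k).
have bYk k : bounded_rv (fun w => Y i w ^+ k) by exact: bounded_rvX.
have smS : sm m.+1 = sm m + Ex (U i).
  rewrite /sm (bigD1 i)//= addrC; congr (_ + _); apply: eq_bigl => j.
  by rewrite ltnS ltn_neqAle andbC.
have bS1 : bounded_rv (S i) by exact: bS 1%N.
have E1Y : Ex (fun w => Y i w ^+ 1) = 0 by rewrite -(EY i).
have Y2_ge0 : 0 <= Ex (fun w => Y i w ^+ 2).
  by rewrite Rintegral_ge0// => w _; exact: sqr_ge0.
have u0 : 0 <= Ex (U i) by case/andP: (EU01 i).
have hm := sm0 m; have hY2 := EY2 i; have hY4 := EY4 i.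
have -> : S m.+1 = fun w => S i w + Y i w by apply/funext => w; exact: SS i w.
rewrite smS; split.
- by rewrite (ExD _ bS1 (bY i)) EY addr0.
- rewrite (@eq_Ex _ _ _ P _ (fun w => S i w ^+ 2 + Y i w ^+ 2 +
      2 * (S i w ^+ 1 * Y i w ^+ 1))); last by move=> w /=; ring.
  have b2 k := bounded_rvD (bS k) (bYk k).
  rewrite (ExD _ (b2 _) (bounded_rvM (bounded_rv_cst _) (bSY _ _))) (ExD _ (bS _) (bYk _)).
  by rewrite (ExZl _ _ (bSY _ _)) E E1Y !mulr0 addr0 lerD.
rewrite (@eq_Ex _ _ _ P _ (fun w => S i w ^+ 4 + Y i w ^+ 4 +
  (4 * (S i w ^+ 3 * Y i w ^+ 1) + 6 * (S i w ^+ 2 * Y i w ^+ 2) +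
   4 * (S i w ^+ 1 * Y i w ^+ 3)))); last by move=> w /=; ring.
have bc c k l := bounded_rvM (bounded_rv_cst c) (bSY k l).
have b4 k := bounded_rvD (bS k) (bYk k).
rewrite (ExD _ (b4 _) (bounded_rvD (bounded_rvD (bc _ _ _) (bc _ _ _)) (bc _ _ _))).
rewrite (ExD _ (bS _) (bYk _)) (ExD _ (bounded_rvD (bc _ _ _) (bc _ _ _)) (bc _ _ _)).
rewrite (ExD _ (bc _ _ _) (bc _ _ _)) !(ExZl _ _ (bSY _ _)) !E E1Y.
rewrite [Ex (fun w => S i w ^+ 1)]E1 !mulr0 mul0r mulr0 addr0 add0r.
have : Ex (fun w => S i w ^+ 2) * Ex (fun w => Y i w ^+ 2) <= sm m * Ex (U i).
  apply: le_trans (ler_wpM2r Y2_ge0 E2) _; exact: ler_wpM2l.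
have : 0 <= Ex (U i) ^+ 2 by exact: sqr_ge0.
move: E4; rewrite -/(S m) !sqrrD /i/=; lra.
Qed.

End fourth_moment.
End independence.

(** * Cofinal sequences, cells of a bounded function, scalar inequalities *)

Section real_lemmas.
Context {R : realType}.

(** Three cases: [A] is unbounded above, [sup A] is attained, or it is only approached. The sequence
    need not be monotone. *)
Lemma cofinal_sequence (A : set R) : A !=set0 -> exists u : nat -> R,
  (forall m, A (u m)) /\
  forall v, A v -> exists M, forall m, (M <= m)%N -> v <= u m.
Proof.
move=> A0; have [ubA|nubA] := pselect (has_ubound A); last first.
  have unb (m : nat) : exists x, A x /\ m%:R <= x.
    apply: contrapT => H; apply: nubA; exists m%:R => x Ax.
    by rewrite leNgt; apply/negP => /ltW mx; apply: H; exists x.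
  have [u Hu] := choice unb; exists u; split=> [m|v Av]; first by case: (Hu m).
  exists (Num.truncn v).+1 => m; rewrite -(ler_nat R) => vm.
  apply: le_trans (ltW (truncnS_gt v)) _; apply: le_trans vm _.
  by case: (Hu m).
have [maxA|nmaxA] := pselect (A (sup A)).
  exists (fun=> sup A); split=> // v Av; exists 0%N => m _.
  exact: ub_le_sup.
have adh (m : nat) : exists x, A x /\ sup A - m.+1%:R^-1 < x.
  have [//|x Ax ltx] := @sup_adherent R A m.+1%:R^-1 _ (conj A0 ubA).
  by exists x.
have [u Hu] := choice adh; exists u; split=> [m|v Av]; first by case: (Hu m).
have vA : v < sup A.
  rewrite lt_neqAle ub_le_sup// andbT; apply/eqP => vE; apply: nmaxA.
  by rewrite -vE.
exists (Num.truncn (sup A - v)^-1) => m Mm; have [_ /ltW] := Hu m.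
apply: le_trans; rewrite lerBrDl addrC -lerBrDl.
rewrite -[leRHS]invrK lef_pV2 ?posrE ?ltr0n ?invr_gt0 ?subr_gt0//.
apply: le_trans (ltW (truncnS_gt _)) _.
by rewrite ler_nat.
Qed.

(* The cells of [G] at scale [N^-1] need not contain their end points, so
   they are exhausted from both sides by sequences. *)
Lemma cell_brackets (G : R -> R) (N : nat) : (0 < N)%N ->
  (forall v, 0 <= G v <= 1) ->
  exists t : nat -> 'I_N.+1 * bool -> R, forall v, exists j,
    (forall m b, `|G (t m (j, b)) - G v| <= N%:R^-1) /\
    exists M, forall m, (M <= m)%N -> t m (j, false) <= v <= t m (j, true).
Proof.
move=> N0 G01; have N0' : (0 : R) < N%:R by rewrite ltr0n.
pose A (j : 'I_N.+1) := [set v | Num.truncn (G v * N%:R) = j].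
have seqs j : exists t : nat -> bool -> R, A j !=set0 ->
    (forall m b, A j (t m b)) /\ forall v, A j v ->
    exists M, forall m, (M <= m)%N -> t m false <= v <= t m true.
  (* Empty cells get the dummy point 0; the cell later chosen for [v] contains [v], so it is never
     one of these. *)
  have [Aj0|] := pselect (A j !=set0); last by exists (fun _ _ => 0).
  have [u [Au Hu]] := cofinal_sequence (A j) Aj0.
  (* Lower brackets come from a cofinal sequence of the reflected cell. *)
  have [|l [Al Hl]] := cofinal_sequence [set x | A j (- x)].
    by case: Aj0 => x Ax; exists (- x); rewrite /= opprK.
  exists (fun m b => if b then u m else - l m) => _; split.
    by move=> m [|]; [exact: Au|exact: Al].
  move=> v Av.
  have [M1 H1] := Hu v Av; have [|M2 H2] := Hl (- v); first by rewrite /= opprK.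
  exists (maxn M1 M2) => m; rewrite geq_max => /andP[m1 m2].
  by rewrite H1// lerNl H2.
have [t Ht] := choice seqs.
exists (fun m jb => t jb.1 m jb.2) => v.
have GN0 x : 0 <= G x * N%:R by have /andP[? _] := G01 x; rewrite mulr_ge0.
(* The value [G v = 1] has index [N], hence [N.+1] cells. *)
have vN : (Num.truncn (G v * N%:R)%R < N.+1)%N.
  rewrite ltnS -(ler_nat R); have /andP[lo _] := truncn_itv (GN0 v).
  apply: le_trans lo _; have /andP[_ ?] := G01 v.
  by rewrite -[leRHS]mul1r ler_pM2r.
pose j := Ordinal vN; exists j; have Av : A j v by [].
have [At Hv] := Ht j (ex_intro _ v Av); split=> [m b|] /=; last exact: Hv.
have /andP[] := truncn_itv (GN0 (t j m b)); have /andP[] := truncn_itv (GN0 v).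
rewrite (At m b : Num.truncn _ = _) /= -natr1 => a1 a2 a3 a4.
rewrite -(ler_pM2r N0') mulVf ?gt_eqF// -[X in _ * X]gtr0_norm// -normrM mulrBl.
by rewrite ler_norml; lra.
Qed.

Lemma le_limn_einf (u : nat -> \bar R) (x : \bar R) (M : nat) :
  (forall m, (M <= m)%N -> (x <= u m)%E) -> (x <= limn_einf u)%E.
Proof.
move=> xu; rewrite limn_einf_lim; apply: lime_ge; first exact: is_cvg_einfs.
exists M => // m /= Mm; apply: le_ereal_inf_tmp => _ [k /= mk <-].
by apply: xu; exact: leq_trans Mm mk.
Qed.

Lemma limn_einf_le (u : nat -> \bar R) (x : \bar R) :
  (forall m, (u m <= x)%E) -> (limn_einf u <= x)%E.
Proof.
move=> ux; rewrite limn_einf_lim; apply: lime_le; first exact: is_cvg_einfs.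
apply: nearW => m; apply: le_trans (ux m); apply: ereal_inf_lbound.
by exists m => /=.
Qed.

(** [K] is one more than the integer base-2 logarithm of [r]. *)
Lemma dyadic_scale (r : R) : 1 <= r ->
  exists K, 2^-1 ^+ K <= r^-1 /\ r^-1 <= 2 * 2^-1 ^+ K.
Proof.
move=> r1; have r0 : 0 < r by exact: lt_le_trans r1.
have /andP[lo hi] := truncn_itv (ltW r0).
have m0 : (0 < Num.truncn r)%N by rewrite truncn_gt_nat.
have /andP[jlo jhi] := trunc_log_bounds (isT : (1 < 2)%N) m0.
set j := trunc_log 2 _ in jlo jhi.
have p0 k : (0 : R) < 2 ^+ k by rewrite exprn_gt0.
exists j.+1; rewrite exprS mulrA mulfV ?pnatr_eq0// mul1r -exprS !exprVn.
rewrite !lef_pV2 ?posrE//; split.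
  apply: le_trans (ltW hi) _; rewrite -natrX ler_nat; exact: jhi.
by apply: le_trans lo; rewrite -natrX ler_nat.
Qed.

(** Below [a] the first term suffices, above it the second. This bounds a maximum over a net by [a]
    plus a sum of fourth powers. *)
Lemma norm_le_fourth_power (a x : R) : 0 < a -> `|x| <= a + x ^+ 4 / a ^+ 3.
Proof.
move=> a0; have a3 : 0 < a ^+ 3 by rewrite exprn_gt0.
have x4 : x ^+ 4 = `|x| ^+ 4.
  by rewrite -normrX ger0_norm// (exprM _ 2 2) sqr_ge0.
rewrite x4; have [xa|/ltW ax] := leP `|x| a.
  by apply: le_trans xa _; rewrite lerDl divr_ge0 ?exprn_ge0// ltW.
apply: (@le_trans _ _ (`|x| ^+ 4 / a ^+ 3)); last by rewrite lerDr ltW.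
rewrite ler_pdivlMr// [leRHS]exprS ler_wpM2l// lerXn2r// nnegrE ltW//.
Qed.

End real_lemmas.

(** * Chaining for the deviation of the average *)

Section chaining.
Local Set Implicit Arguments.
Local Unset Strict Implicit.
Context {R : realType} {d : measure_display} {T : measurableType d}.
Variables (P : probability T R) (n : nat) (F : 'I_n -> T -> R -> R).
Hypothesis n_gt0 : (0 < n)%N.
Hypothesis F_homo : forall i w, {homo F i w : x y / x <= y}.
Hypothesis F01 : forall i w v, 0 <= F i w v <= 1.
Hypothesis mF : forall i v, measurable_fun setT (fun w => F i w v).
Hypothesis F_indep : independent_fun_rvs P F.

Local Notation Ex X := (Rintegral P setT X).
Local Notation G := (EFavg P F).
Local Notation D := (fun w v => Favg F w v - EFavg P F v).

Lemma bounded_rvF i v : bounded_rv (fun w => F i w v).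
Proof.
split=> //; exists 1 => w; have /andP[? ?] := F01 i w v.
by rewrite ger0_norm.
Qed.

Lemma EFavgE v : G v = n%:R^-1 * \sum_i Ex (fun w => F i w v).
Proof.
have b i := bounded_rvF i v.
rewrite /EFavg /Favg ExZl ?Ex_sum//; exact: bounded_rv_sum.
Qed.

Lemma EFavg01 v : 0 <= G v <= 1.
Proof.
have b w : 0 <= Favg F w v <= 1.
  rewrite /Favg mulr_ge0 ?invr_ge0 ?sumr_ge0//=; last first.
    by move=> i _; case/andP: (F01 i w v).
  rewrite ler_pdivrMl ?ltr0n// mulr1.
  apply: (@le_trans _ _ (\sum_(i < n) 1)); last by rewrite sumr_const card_ord.
  by apply: ler_sum => i _; case/andP: (F01 i w v).
have bF : bounded_rv (Favg F ^~ v).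
  apply: bounded_rvM; [exact: bounded_rv_cst | apply: bounded_rv_sum => i _].
  exact: bounded_rvF.
rewrite -{1}(Ex_cst P 0) -(Ex_cst P 1).
by apply/andP; split; apply: Ex_le => //; [exact: bounded_rv_cst|
  move=> w; case/andP: (b w)|exact: bounded_rv_cst|move=> w; case/andP: (b w)].
Qed.

Lemma bounded_rv_deviation v : bounded_rv (D ^~ v).
Proof.
apply: bounded_rvB; last exact: bounded_rv_cst.
apply: bounded_rvM; [exact: bounded_rv_cst | apply: bounded_rv_sum => i _].
exact: bounded_rvF.
Qed.

Lemma fun_rv_sigma_measurable i A : fun_rv_sigma (F i) A -> measurable A.
Proof.
apply: smallest_sub; first exact: sigma_algebra_measurable.
move=> _ [v [B [mB ->]]]; have := mF i v measurableT mB.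
by rewrite setTI.
Qed.

(** Viewing the generated sigma-algebra as a measurable type gives adaptedness of increments from
    measurability of differences. *)
Let mFs i v (S := g_sigma_algebraType [set A | exists (v : R) (B : set R),
    measurable B /\ A = (fun w => F i w v) @^-1` B]) :
  measurable_fun (setT : set S) (fun w : S => F i w v).
Proof.
move=> _ B mB; rewrite setTI; apply: sub_gen_smallest.
by exists v, B.
Qed.

Lemma adapted_eval i v :
  adapted (fun i => fun_rv_sigma (F i)) i (fun w => F i w v).
Proof. by move=> B mB; have := @mFs i v measurableT _ mB; rewrite setTI. Qed.

Lemma adapted_increment i a b :
  adapted (fun i => fun_rv_sigma (F i)) i (fun w => F i w b - F i w a).
Proof.
move=> B mB.
have := measurable_funB (@mFs i b) (@mFs i a) measurableT mB.
by rewrite setTI.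
Qed.

Lemma average_fourth_moment (U : 'I_n -> T -> R) (e : R) :
    (forall i w, 0 <= U i w <= 1) -> (forall i, measurable_fun setT (U i)) ->
    (forall i, adapted (fun i => fun_rv_sigma (F i)) i (U i)) ->
    \sum_i Ex (U i) <= n%:R * e ->
  Ex (fun w => (n%:R^-1 * \sum_i (U i w - Ex (U i))) ^+ 4) <=
  e / n%:R ^+ 3 + 3 * e ^+ 2 / n%:R ^+ 2.
Proof.
move=> U01 mU aU se.
have bU i : bounded_rv (U i).
  by split=> //; exists 1 => w; have /andP[? ?] := U01 i w; rewrite ger0_norm.
have n0 : (0 : R) < n%:R by rewrite ltr0n.
have s0 : 0 <= \sum_i Ex (U i).
  apply: sumr_ge0 => i _; apply: Rintegral_ge0 => w _.
  by case/andP: (U01 i w).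
have sT i : fun_rv_sigma (F i) setT.
  by have := @adapted_eval i 0 _ measurableT; rewrite preimage_setT.
have := fourth_moment_le sT (@fun_rv_sigma_measurable) F_indep U01 mU aU.
set s := \sum_i _ in se s0 *; set X := Ex _ => Xs.
have -> : Ex (fun w => (n%:R^-1 * \sum_i (U i w - Ex (U i))) ^+ 4) =
    n%:R^-1 ^+ 4 * X.
  rewrite /X -ExZl; first by apply: eq_Ex => w; rewrite exprMn.
  apply: bounded_rvX; apply: bounded_rv_sum => i _.
  by apply: bounded_rvB => //; exact: bounded_rv_cst.
have -> : e / n%:R ^+ 3 + 3 * e ^+ 2 / n%:R ^+ 2 =
    n%:R^-1 ^+ 4 * (n%:R * e + 3 * (n%:R * e) ^+ 2).
  by field; rewrite gt_eqF.
rewrite ler_pM2l ?exprn_gt0 ?invr_gt0//; apply: le_trans Xs _.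
by apply: lerD => //; rewrite ler_pM2l// lerXn2r// nnegrE (le_trans s0).
Qed.

Lemma deviation_fourth_moment v :
  Ex (fun w => D w v ^+ 4) <= n%:R^-1 ^+ 3 + 3 * n%:R^-1 ^+ 2.
Proof.
have bF i := bounded_rvF i v.
have n0 : (0 : R) < n%:R by rewrite ltr0n.
have := @average_fourth_moment (fun i w => F i w v) 1
  (fun i w => F01 i w v) (fun i => mF i v) (fun i => @adapted_eval i v).
rewrite expr1n mul1r !mulr1 !exprVn => H; apply: le_trans (H _).
  rewrite le_eqVlt; apply/orP; left; apply/eqP; apply: eq_Ex => w.
  by rewrite EFavgE /Favg -mulrBr -sumrB.
have /andP[_] := EFavg01 v.
by rewrite EFavgE ler_pdivrMl// mulr1.
Qed.

Lemma increment_fourth_moment a b (e : R) : `|G b - G a| <= e ->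
  Ex (fun w => (D w b - D w a) ^+ 4) <=
  e / n%:R ^+ 3 + 3 * e ^+ 2 / n%:R ^+ 2.
Proof.
have n0 : (0 : R) < n%:R by rewrite ltr0n.
wlog ab : a b / a <= b => [H|] Ge.
  have [/H|/ltW/H] := leP a b; first exact.
  rewrite distrC => /(_ Ge); apply: le_trans.
  rewrite le_eqVlt; apply/orP; left; apply/eqP; apply: eq_Ex => w /=; ring.
have bF i v := bounded_rvF i v.
pose U i w := F i w b - F i w a.
have EU i : Ex (U i) = Ex (fun w => F i w b) - Ex (fun w => F i w a).
  by rewrite ExB.
have Gab : G b - G a = n%:R^-1 * \sum_i Ex (U i).
  by rewrite !EFavgE -mulrBr -sumrB; congr (_ * _); apply: eq_bigr => i _.
apply: le_trans (@average_fourth_moment U e _ _ _ _).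
- rewrite le_eqVlt; apply/orP; left; apply/eqP; apply: eq_Ex => w.
  rewrite sumrB mulrBr -Gab /Favg /U sumrB; ring.
- move=> i w; rewrite /U subr_ge0 F_homo//=.
  by have /andP[? ?] := F01 i w a; have /andP[? ?] := F01 i w b; lra.
- by move=> i; apply: measurable_funB.
- by move=> i; exact: adapted_increment.
- by rewrite -ler_pdivrMl// -Gab; apply: le_trans Ge; exact: ler_norm.
Qed.

(** A bound on the expected supremum of [|D|] over [S], witnessed by a measurable majorant so that
    the supremum itself is never integrated. *)
Definition enveloped (S : set R) (c : R) := exists B : T -> R,
  [/\ bounded_rv B, forall w s, S s -> `|D w s| <= B w & Ex B <= c].

(** Each new point is linked to a point of [S] at [G]-distance at most [e]; the largest link is at
    most [a] plus the sum of all fourth powers over [a ^+ 3]. *)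
Lemma enveloped_step (S : set R) (c a e : R) (I : finType) (t : I -> R) :
    enveloped S c -> 0 < a ->
    (forall j, exists2 s, S s & `|G (t j) - G s| <= e) ->
  enveloped (range t)
    (c + (a + #|I|%:R * (e / n%:R ^+ 3 + 3 * e ^+ 2 / n%:R ^+ 2) / a ^+ 3)).
Proof.
move=> [B [bB SB EB]] a0 near_S.
have /choice[p Hp] : forall j, exists s, S s /\ `|G (t j) - G s| <= e.
  by move=> j; have [s Ss es] := near_S j; exists s.
pose X j w := D w (t j) - D w (p j).
have bX j : bounded_rv (X j).
  by apply: bounded_rvB; exact: bounded_rv_deviation.
have bX4 : bounded_rv (fun w => \sum_j X j w ^+ 4).
  by apply: bounded_rv_sum => j _; exact: bounded_rvX.
have bZ : bounded_rv (fun w => (a ^+ 3)^-1 * \sum_j X j w ^+ 4).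
  by apply: bounded_rvM => //; exact: bounded_rv_cst.
have bC := @bounded_rv_cst R d T a.
exists (fun w => B w + (a + (a ^+ 3)^-1 * \sum_j X j w ^+ 4)); split.
- by apply: bounded_rvD => //; exact: bounded_rvD.
- move=> w _ [j _ <-]; have [Sp _] := Hp j.
  have -> : D w (t j) = D w (p j) + X j w by rewrite /X; ring.
  apply: le_trans (ler_normD _ _) _; apply: lerD; first exact: SB.
  apply: le_trans (norm_le_fourth_power _ (X j w) a0) _.
  rewrite lerD2l mulrC ler_pM2l ?invr_gt0 ?exprn_gt0//.
  rewrite (bigD1 j)//= lerDl sumr_ge0// => k _.
  by rewrite (exprM _ 2 2) sqr_ge0.
- rewrite (ExD _ bB (bounded_rvD bC bZ)) (ExD _ bC bZ) Ex_cst (ExZl _ _ bX4).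
  rewrite lerD// lerD2l mulrC ler_pM2r ?invr_gt0 ?exprn_gt0//.
  rewrite Ex_sum; last by move=> j _; exact: bounded_rvX.
  rewrite mulr_natl -sumr_const; apply: ler_sum => j _.
  by apply: increment_fourth_moment; case: (Hp j).
Qed.

Lemma envelopedW (S : set R) (c c' : R) : c <= c' -> enveloped S c -> enveloped S c'.
Proof.
by move=> cc' [B [bB SB EB]]; exists B; split=> //; exact: le_trans cc'.
Qed.

Let r : R := Num.sqrt n%:R.

Let r_gt0 : 0 < r. Proof. by rewrite sqrtr_gt0 ltr0n. Qed.
Let r_ge1 : 1 <= r. Proof. by rewrite -sqrtr1 ler_sqrt ?ler1n// ltr0n. Qed.
Let nE : n%:R = r ^+ 2. Proof. by rewrite sqr_sqrtr. Qed.

(** With threshold [a = 1 / r] the constant is 1 + 4: the fourth moment is at most [4 / n ^+ 2], and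
    [r ^+ 3 / n ^+ 2 = 1 / r]. *)
Lemma enveloped_point : enveloped [set 0] (5 / r).
Proof.
have bD := bounded_rv_deviation 0; have b4 := bounded_rvX 4 bD.
have bC := @bounded_rv_cst R d T r^-1; have r3 := exprn_gt0 3 r_gt0.
have bZ : bounded_rv (fun w => r ^+ 3 * D w 0 ^+ 4).
  by apply: bounded_rvM => //; exact: bounded_rv_cst.
exists (fun w => r^-1 + r ^+ 3 * D w 0 ^+ 4); split.
- exact: bounded_rvD.
- move=> w _ ->; have ir0 : 0 < r^-1 by rewrite invr_gt0.
  by have := norm_le_fourth_power _ (D w 0) ir0; rewrite exprVn invrK mulrC.
- rewrite (ExD _ bC bZ) Ex_cst (ExZl _ _ b4).
  have H4 := deviation_fourth_moment 0.
  have n1 : (n%:R^-1 : R) <= 1 by rewrite invf_le1 ?ltr0n// ler1n.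
  have n0 : (0 : R) < n%:R^-1 by rewrite invr_gt0 ltr0n.
  have {}H4 : Ex (fun w => D w 0 ^+ 4) <= 4 * n%:R^-1 ^+ 2.
    apply: le_trans H4 _; rewrite exprS; have := exprn_gt0 2 n0; nra.
  have -> : 5 / r = r^-1 + r ^+ 3 * (4 * n%:R^-1 ^+ 2).
    by rewrite nE; field; rewrite gt_eqF.
  by rewrite lerD2l ler_pM2l.
Qed.

(* The condition [r^-1 <= 2 * e] makes [e / n ^ 3] at most [2 * e ^ 2 / n ^ 2]:
   above the scale [n^-1/2] the fourth moment is Gaussian. *)
Lemma chaining_cost (N e q : R) : 0 < e -> 0 < q -> 0 <= N -> r^-1 <= 2 * e ->
  q / r + N * (e / n%:R ^+ 3 + 3 * e ^+ 2 / n%:R ^+ 2) / (q / r) ^+ 3 <=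
  (q + 5 * (N * e ^+ 2) / q ^+ 3) / r.
Proof.
move=> e0 q0 N0 re; rewrite nE.
have -> : N * (e / (r ^+ 2) ^+ 3 + 3 * e ^+ 2 / (r ^+ 2) ^+ 2) / (q / r) ^+ 3 =
    N * e / q ^+ 3 / r * (r^-1 ^+ 2 + 3 * e).
  by field; rewrite !gt_eqF.
have -> : (q + 5 * (N * e ^+ 2) / q ^+ 3) / r = q / r +
    N * e / q ^+ 3 / r * (2 * e + 3 * e) by field; rewrite !gt_eqF.
rewrite lerD2l ler_wpM2l//.
  by rewrite !(divr_ge0, mulr_ge0) ?exprn_ge0// ltW.
rewrite lerD2r; apply: le_trans re; rewrite expr2 ler_piMl ?invf_le1//.
by rewrite invr_ge0 ltW.
Qed.

Let p : R := 2^-1.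
(* Any ratio with [1/2 < q ^ 4] and [q < 1] makes the chaining costs summable. *)
Let q : R := 9 / 10.

(** Passing from level [k] to [k.+1] costs at most [31 * q ^+ k / r]. Starting from 5, the geometric
    sum of ratio 9/10 is [5 + 310 * (1 - q ^+ k)]. *)
Lemma dyadic_nets K : r^-1 <= 2 * p ^+ K -> forall k, (k <= K)%N ->
  exists S, enveloped S ((315 - 310 * q ^+ k) / r) /\
  forall v, exists2 s, S s & `|G v - G s| <= p ^+ k.
Proof.
move=> rK; have p0 k : 0 < p ^+ k by rewrite exprn_gt0// invr_gt0.
have q0 k : 0 < q ^+ k by rewrite exprn_gt0// divr_gt0.
elim=> [|k IH] kK.
  exists [set 0]; split.
    by rewrite expr0 (_ : 315 - _ = 5); [exact: enveloped_point | ring].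
  move=> v; exists 0 => //; rewrite expr0.
  by have /andP[? ?] := EFavg01 v; have /andP[? ?] := EFavg01 0; rewrite ler_norml; lra.
have [S [envS HS]] := IH (ltnW kK); pose N := (2 ^ k.+1)%N.
have N0 : (0 < N)%N by rewrite expn_gt0.
have [t Ht] := cell_brackets _ _ N0 EFavg01.
exists (range (t 0%N)); split; last first.
  move=> v; have [j [Hj _]] := Ht v; exists (t 0%N (j, true)); first by exists (j, true).
  by rewrite distrC; apply: le_trans (Hj _ _) _; rewrite /N /p natrX exprVn.
have a0 : 0 < q ^+ k / r by rewrite divr_gt0.
have step := enveloped_step envS a0 (fun j => HS (t 0%N j)).
apply: envelopedW step.
have kK' : p ^+ K <= p ^+ k.
  by apply: ler_wiXn2l; [rewrite /p; lra..|exact: ltnW].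
have rk : r^-1 <= 2 * p ^+ k by apply: le_trans rK _; rewrite ler_pM2l.
set card := (#|_|%:R : R).
(* There are [2 ^ k.+1 + 1] cells with two brackets each. *)
have cardE : card = 4 * (p ^+ k)^-1 + 2.
  rewrite /card card_prod card_ord card_bool /N natrM -natr1 natrX exprS /p exprVn invrK.
  ring.
have card0 : 0 <= card by exact: ler0n.
have := chaining_cost (p0 k) (q0 k) card0 rk; set cost := (X in X <= _) => Hcost.
apply: (@le_trans _ _ ((315 - 310 * q ^+ k) / r + (31 * q ^+ k) / r)); last first.
  by rewrite -mulrDl ler_pM2r ?invr_gt0// exprS /q; lra.
rewrite lerD2l; apply: le_trans Hcost _; rewrite ler_pM2r ?invr_gt0//.
have cp : card * (p ^+ k) ^+ 2 <= 6 * p ^+ k.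
  rewrite cardE expr2 mulrA ler_pM2r// mulrDl -mulrA mulVf ?gt_eqF//.
  have : p ^+ k <= 1 by rewrite exprn_ile1// /p; lra.
  lra.
(* Here [p <= q ^+ 4] enters: the fourth moments cost at most [5 * 6 * p ^+ k / q ^+ (3 * k) <= 30 *
   q ^+ k], and the threshold adds [q ^+ k]. *)
have pq : p ^+ k <= q ^+ k * (q ^+ k) ^+ 3.
  rewrite -exprS -exprM mulnC exprM lerXn2r// ?nnegrE /p /q; lra.
have : 5 * (card * (p ^+ k) ^+ 2) / (q ^+ k) ^+ 3 <= 30 * q ^+ k.
  rewrite ler_pdivrMr; last exact: exprn_gt0 (q0 k).
  by rewrite -mulrA; lra.
lra.
Qed.

Lemma expected_deviation_le :
  (\int[P]_w supnorm (fun v => (D w v)%R) <= (337 / r)%:E)%E.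
Proof.
have [K [Kr rK]] := dyadic_scale _ r_ge1.
have [S [envS HS]] := dyadic_nets rK (leqnn K).
pose N := (2 ^ K)%N; have N0 : (0 < N)%N by rewrite expn_gt0.
have NE : N%:R^-1 = p ^+ K by rewrite /N /p natrX exprVn.
have [t Ht] := cell_brackets _ _ N0 EFavg01.
have pK0 : 0 < p ^+ K by rewrite exprn_gt0// invr_gt0.
(* One last link, uniform in [m], with threshold [1 / r]: since [card * (p ^+ K) ^+ 2 <= 4], it
   costs 1 + 5 * 4 = 21 on top of 315. *)
have envt m : enveloped (range (t m)) (336 / r).
  have a0 : 0 < 1 / r by rewrite divr_gt0.
  apply: envelopedW (enveloped_step envS a0 (fun j => HS (t m j))).
  set card := (#|_|%:R : R).
  have cardE : card = 2 * (p ^+ K)^-1 + 2.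
    rewrite /card card_prod card_ord card_bool /N natrM -natr1 natrX /p exprVn invrK.
    ring.
  have card0 : 0 <= card by exact: ler0n.
  have := chaining_cost pK0 ltr01 card0 rK; set cost := (X in X <= _) => Hcost.
  apply: (@le_trans _ _ ((315 - 310 * q ^+ K) / r + 21 / r)); last first.
    rewrite -mulrDl ler_pM2r ?invr_gt0//.
    have : 0 <= q ^+ K by rewrite exprn_ge0// divr_ge0.
    lra.
  rewrite lerD2l; apply: le_trans Hcost _; rewrite ler_pM2r ?invr_gt0//.
  have pK1 : p ^+ K <= 1 by rewrite exprn_ile1// /p; lra.
  have -> : card * (p ^+ K) ^+ 2 = 2 * p ^+ K + 2 * (p ^+ K) ^+ 2.
    by rewrite cardE; field; rewrite gt_eqF.
  rewrite expr1n divr1.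
  by have : (p ^+ K) ^+ 2 <= 1 by [rewrite expr2; nra]; lra.
have [B HB] := choice envt.
pose f m w := (B m w + p ^+ K)%:E.
have bB m : bounded_rv (B m) by case: (HB m).
have bf m : bounded_rv (fun w => B m w + p ^+ K).
  by apply: bounded_rvD => //; exact: bounded_rv_cst.
have t0 m : range (t m) (t m (ord0, true)) by exists (ord0, true).
have f0 m w : (0 <= f m w)%E.
  rewrite lee_fin addr_ge0 ?(ltW pK0)//; have [_ HBm _] := HB m.
  exact: le_trans (HBm w _ (t0 m)).
(* The rank from which [v] is bracketed depends on [v], so only the lower limit of the [f m]
   dominates the sup norm. *)
apply: (@le_trans _ _ (\int[P]_w limn_einf (f ^~ w))%E).
  apply: ge0_le_lower_integral => w.
    apply: (@le_trans _ _ (`|D w 0|)%:E); first by rewrite lee_fin.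
    by apply: ereal_sup_ubound; exists 0.
  apply: ge_ereal_sup => _ [v _ <-]; have [j [Gj [M HM]]] := Ht v.
  apply: (@le_limn_einf _ _ _ M) => m /HM /andP[tv vt].
  have avgm x y : x <= y -> Favg F w x <= Favg F w y.
    move=> xy; rewrite /Favg ler_wpM2l ?invr_ge0//; apply: ler_sum => i _.
    exact: F_homo.
  have [_ HBm _] := HB m.
  have := HBm w _ (ex_intro2 _ _ (j, false) Logic.I erefl).
  have := HBm w _ (ex_intro2 _ _ (j, true) Logic.I erefl).
  have := Gj m true; have := Gj m false; have := avgm _ _ tv; have := avgm _ _ vt.
  (* [Favg F w v] lies between its values at the two brackets, where [G] differs from [G v] by at
     most [p ^+ K]. *)
  by rewrite NE lee_fin !ler_norml; lra.
apply: le_trans (fatou _ _ _ _) _ => //.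
  by move=> m; apply/measurable_EFinP; case: (bf m).
apply: limn_einf_le => m; rewrite Ex_EFin// lee_fin.
rewrite (ExD _ (bB m) (bounded_rv_cst _)) Ex_cst.
have [_ _ EB] := HB m.
(* The extra [r^-1] pays for the oscillation [p ^+ K] of [G] on a cell. *)
have -> : 337 / r = 336 / r + r^-1 by field; rewrite gt_eqF.
exact: lerD.
Qed.

End chaining.

Theorem theoremB2 (R : realType) :
  exists C : R,
  forall (d : measure_display) (T : measurableType d) (P : probability T R)
         (n : nat) (F : 'I_n -> T -> R -> R),
    (0 < n)%N ->
    (forall i w, {homo F i w : x y / x <= y}) ->
    (forall i w v, 0 <= F i w v <= 1) ->
    (forall i v, measurable_fun setT (fun w => F i w v)) ->
    independent_fun_rvs P F ->
    (\int[P]_w supnorm (fun v => (Favg F w v - EFavg P F v)%R)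
       <= (C / Num.sqrt n%:R)%:E)%E.
Proof.
exists 337 => d T P n F n_gt0 F_homo F01 mF F_indep.
exact: expected_deviation_le.
Qed.
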